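(* Let $n\ge1$ and let $\alpha,\beta\vDash n$ be compositions. 1. If $\mathrm{SIT}_{\mathfrak{S}^*}(\alpha;\beta)\ne\emptyset$, then $\ell(\alpha)\ge\max\beta^c$. 2. If $\mathrm{SRIT}_{\mathfrak{S}^*}(\alpha;\beta)\ne\emptyset$, then $\ell(\alpha)\ge\max\beta^c$. 3. If $\mathrm{SIT}_{R\mathfrak{S}^*}(\alpha;\beta)\ne\emptyset$, then $\ell(\alpha)\ge\max\beta$. 4. If $\mathrm{SRIT}_{R\mathfrak{S}^*}(\alpha;\beta)\ne\emptyset$, then $\ell(\alpha)\ge\max\beta$.
   Context: A composition $\alpha=(\alpha_1,\dots,\alpha_\ell)\vDash n$ is a finite list of positive integers with sum $n$; $\ell(\alpha)=\ell$ and $\max\alpha=\max_i\alpha_i$. Write $\mathrm{Set}(\alpha)=\{\alpha_1,\alpha_1+\alpha_2,\dots,\alpha_1+\cdots+\alpha_{\ell-1}\}\subseteq[n-1]=\{1,\dots,n-1\}$, and let $\mathrm{Comp}$ be the inverse bijection from subsets of $[n-1]$ to compositions of $n$. The complement is $\alpha^c=\mathrm{Comp}([n-1]\setminus\mathrm{Set}(\alpha))$. The diagram of $\alpha$ is the left-justified array of cells with $\alpha_i$ cells in row $i$, rows numbered from bottom to top. $\mathrm{SIT}(\alpha)$ (standard immaculate tableaux) is the set of bijective fillings of the diagram of $\alpha$ with $1,\dots,n$ such that entries increase from bottom to top in the first (leftmost) column and from left to right in each row. $\mathrm{SRIT}(\alpha)$ (standard reverse immaculate tableaux) is the set of bijective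 fillings with $1,\dots,n$ such that entries increase from bottom to top in the first (leftmost) column and from right to left in each row. For $T$ in either set, $\mathrm{Des}_{\mathfrak{S}^*}(T)=\{i\in[n-1]\mid i+1$ is in a strictly higher row than $i$ in $T\}$ and $\mathrm{Des}_{R\mathfrak{S}^*}(T)=\{i\in[n-1]\mid i+1$ is in the same row as or a lower row than $i$ in $T\}$. For $\ast\in\{\mathfrak{S}^*,R\mathfrak{S}^*\}$, the $\ast$-descent composition of $T$ is $\mathrm{Comp}(\mathrm{Des}_\ast(T))$, and $\mathrm{SIT}_\ast(\alpha;\beta)$ (resp. $\mathrm{SRIT}_\ast(\alpha;\beta)$) is the set of $T\in\mathrm{SIT}(\alpha)$ (resp. $T\in\mathrm{SRIT}(\alpha)$) with $\ast$-descent composition $\beta$. *)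

(* Defs.v *)
From mathcomp Require Import all_boot.

Set Implicit Arguments.
Unset Strict Implicit.
Unset Printing Implicit Defensive.

Definition is_comp (n : nat) (a : seq nat) : bool :=
  all (leq 1) a && (sumn a == n).

Definition max_part (a : seq nat) : nat := \max_(p <- a) p.

Definition interval (n : nat) : seq nat := iota 1 n.-1.

Definition comp_set (a : seq nat) : seq nat :=
  [seq sumn (take i a) | i <- iota 1 (size a).-1].

(** For [D = {d_1 < .. < d_k}], a subset of [{1,..,n-1}], this is
    [(d_1, d_2 - d_1, .., n - d_k)].  The list [D] need not be
    sorted, and its elements outside [{1,..,n-1}] are ignored.  For [0 < n], this
    is the inverse of [comp_set] by [set_comp_is_comp], [set_compE] and
    [comp_setK]. *)
Definition set_comp (n : nat) (D : seq nat) : seq nat :=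
  pairmap (fun x y => y - x) 0 (rcons [seq i <- interval n | i \in D] n).

Definition compl_comp (n : nat) (a : seq nat) : seq nat :=
  set_comp n [seq i <- interval n | i \notin comp_set a].

(** A filling is the list of its rows, from bottom to top, each row being read
    from left to right; so a higher row has a larger index. *)
Definition filling := seq (seq nat).

Definition std_filling (a : seq nat) (T : filling) : bool :=
  (shape T == a) && perm_eq (flatten T) (iota 1 (sumn a)).

Definition first_column (T : filling) : seq nat := [seq head 0 r | r <- T].

Definition SIT (a : seq nat) : pred filling :=
  [pred T | [&& std_filling a T, sorted ltn (first_column T)
              & all (sorted ltn) T]].

Definition SRIT (a : seq nat) : pred filling :=
  [pred T | [&& std_filling a T, sorted ltn (first_column T)
              & all (sorted gtn) T]].

Definition row_of (T : filling) (i : nat) : nat := find (fun r => i \in r) T.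

Definition Des_S (n : nat) (T : filling) : seq nat :=
  [seq i <- interval n | row_of T i < row_of T i.+1].

Definition Des_RS (n : nat) (T : filling) : seq nat :=
  [seq i <- interval n | row_of T i.+1 <= row_of T i].

Definition SIT_S (n : nat) (a b : seq nat) : pred filling :=
  [pred T in SIT a | set_comp n (Des_S n T) == b].

Definition SRIT_S (n : nat) (a b : seq nat) : pred filling :=
  [pred T in SRIT a | set_comp n (Des_S n T) == b].

Definition SIT_RS (n : nat) (a b : seq nat) : pred filling :=
  [pred T in SIT a | set_comp n (Des_RS n T) == b].

Definition SRIT_RS (n : nat) (a b : seq nat) : pred filling :=
  [pred T in SRIT a | set_comp n (Des_RS n T) == b].

Lemma sumn_take_pairmap x s i : path leq x s -> i <= size s ->
  sumn (take i (pairmap (fun x y => y - x) x s)) = nth x (x :: s) i - x.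
Proof.
elim: s x i => [|y s IHs] x [|i] //=; rewrite ?subnn //.
move=> /andP[xy ys] lti; rewrite (IHs _ _ ys lti).
have le_y : y <= nth y (y :: s) i.
  case: i lti => [|i] //= lti.
  by apply: (allP (order_path_min leq_trans ys)); rewrite mem_nth.
rewrite (set_nth_default y) //= addnC addnBA // subnK //.
Qed.

Lemma comp_set_pairmap s n : path leq 0 (rcons s n) ->
  comp_set (pairmap (fun x y => y - x) 0 (rcons s n)) = s.
Proof.
move=> ps; rewrite /comp_set size_pairmap size_rcons /=.
apply: (@eq_from_nth _ 0) => [|i]; rewrite size_map size_iota // => lti.
rewrite (nth_map 0) ?size_iota // nth_iota // add1n sumn_take_pairmap //.
  by rewrite subn0 /= nth_rcons lti.
by rewrite size_rcons ltnW.
Qed.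

Lemma path_filter_interval n (D : seq nat) : 0 < n ->
  path ltn 0 (rcons [seq i <- interval n | i \in D] n).
Proof.
case: n => // n _; rewrite /interval /=.
have: subseq (rcons [seq i <- iota 1 n | i \in D] n.+1) (iota 1 n.+1).
  rewrite -(addn1 n) iotaD /= add1n -cats1 addn1.
  by apply: cat_subseq; rewrite ?filter_subseq.
move=> /(subseq_path ltn_trans) -> //.
exact: (iota_ltn_sorted 0 n.+2).
Qed.

Lemma set_compE n (D : seq nat) : 0 < n ->
  comp_set (set_comp n D) = [seq i <- interval n | i \in D].
Proof.
move=> n0; apply: comp_set_pairmap.
by apply: sub_path (path_filter_interval D n0) => x y /ltnW.
Qed.

Lemma set_comp_is_comp n (D : seq nat) : 0 < n -> is_comp n (set_comp n D).
Proof.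
move=> n0; have pD := path_filter_interval D n0.
rewrite /is_comp /set_comp; apply/andP; split.
  move: (rcons _ _) pD => s.
  have gen x : path ltn x s -> all (leq 1) (pairmap (fun x y => y - x) x s).
    elim: s x => //= y s IHs x /andP[xy ys].
    by rewrite IHs // andbT -/(0 < y - x) subn_gt0.
  exact: gen.
set s := rcons _ _ in pD *.
have ps : path leq 0 s by apply: sub_path pD => x y /ltnW.
rewrite -(take_size (pairmap _ _ _)) size_pairmap sumn_take_pairmap // subn0.
by rewrite /s size_rcons /= nth_rcons ltnn eqxx.
Qed.

Lemma comp_setK n a : 0 < n -> is_comp n a -> set_comp n (comp_set a) = a.
Proof.
move=> n0 /andP[a_pos /eqP sum_a].
pose P (i : nat) := sumn (take i a).
have PS i : i < size a -> P i.+1 = P i + nth 0 a i.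
  by move=> lti; rewrite /P (take_nth 0) // sumn_rcons.
have Plt i j : i < j <= size a -> P i < P j.
  case/andP; elim: j => // j IHj; rewrite ltnS leq_eqVlt => ij lj.
  have aj : 0 < nth 0 a j by apply: (allP a_pos); rewrite mem_nth.
  rewrite PS //; case/orP: ij => [/eqP->|ij].
    by rewrite -[ltnLHS]addn0 ltn_add2l.
  by apply: leq_trans (IHj ij (ltnW lj)) (leq_addr _ _).
have Psz : P (size a) = n by rewrite /P take_size.
have sz0 : 0 < size a by case: (a) sum_a n0 => //= <-.
have srt : sorted ltn (comp_set a).
  apply: (homo_sorted_in (P := [pred i | i <= size a]) (e := ltn)).
  - by move=> i j _ /= lj ij; apply: Plt; apply/andP.
  - apply/allP=> i; rewrite mem_iota add1n prednK // inE => /andP[_ /ltnW//].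
  - exact: iota_ltn_sorted.
have eqD : [seq i <- interval n | i \in comp_set a] = comp_set a.
  apply: (irr_sorted_eq ltn_trans ltnn) => //.
    by apply: sorted_filter; [exact: ltn_trans | exact: iota_ltn_sorted].
  move=> x; rewrite mem_filter andb_idr // => /mapP[i].
  rewrite !mem_iota !add1n !prednK // => /andP[i1 ilt] ->.
  have lt_n : P i < n by rewrite -Psz Plt // ilt leqnn.
  have gt_0 : 0 < P i by have := @Plt 0 i; rewrite i1 (ltnW ilt) {1}/P take0; apply.
  by rewrite -/(P i) gt_0.
have eqr : rcons (comp_set a) n = [seq P i | i <- iota 1 (size a)].
  have -> : iota 1 (size a) = iota 1 (size a).-1 ++ [:: size a].
    by rewrite -{1}(prednK sz0) -(addn1 (size a).-1) iotaD /= add1n prednK.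
  by rewrite map_cat /= Psz cats1.
rewrite /set_comp eqD eqr.
apply: (@eq_from_nth _ 0); rewrite size_pairmap size_map size_iota // => i lti.
rewrite (nth_pairmap 0) ?size_map ?size_iota //.
rewrite (nth_map 0) ?size_iota // nth_iota // add1n PS //.
have -> : nth 0 (0 :: [seq P j | j <- iota 1 (size a)]) i = P i.
  case: i lti => [|i] lti /=; first by rewrite /P take0.
  by rewrite (nth_map 0) ?size_iota ?nth_iota // ltnW.
by rewrite addKn.
Qed.

(* Main.v *)
Require Import Defs.
From mathcomp Require Import all_boot.

(** Record the row in which each entry sits, and cut [1 .. n] at the reverse
    descents.  Within a block of the cut, consecutive entries are not reverse
    descents, so their rows strictly increase; the entries of a block therefore
    lie in pairwise distinct rows, and no block is longer than the number of
    rows, which is the length of [alpha] ([max_part_set_comp_le],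
    [max_part_Des_RS]).

    The blocks of this cut are the parts of the reverse descent composition,
    which settles the last two claims.  For the first two, the reverse descent
    set is the complement of the descent set, so the complement of the descent
    composition is that same composition ([compl_comp_Des_S]). *)

(** Turns a part of a composition into an explicit interval free of cuts, on
    which one can argue index by index.  The bound [x <= u] serves the
    induction: it keeps the cut prepended to [s] outside the interval. *)
Lemma pairmap_subn_gap (x : nat) (s : seq nat) (p : nat) :
    path ltn x s -> p \in pairmap (fun y z => z - y) x s ->
  exists u v, [/\ p = v - u, x <= u, v \in s
                & forall w, u < w < v -> w \notin s].
Proof.
elim: s x => //= y s IHs x /andP[lt_xy path_s].
rewrite inE => /orP[/eqP-> | /(IHs _ path_s) [u [v [-> le_yu v_s no_cut]]]].
  exists x, y; split; rewrite ?mem_head // => w /andP[_ lt_wy].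
  rewrite inE negb_or ltn_eqF //=; apply/negP => w_s.
  have /allP/(_ w w_s) lt_yw := order_path_min ltn_trans path_s.
  by have := ltn_trans lt_wy lt_yw; rewrite ltnn.
exists u, v; split; rewrite ?(leq_trans (ltnW lt_xy)) ?inE ?v_s ?orbT //.
move=> w lt_uwv; rewrite inE negb_or no_cut // andbT.
by case/andP: lt_uwv => lt_uw _; rewrite gtn_eqF // (leq_ltn_trans le_yu).
Qed.

(** On each block cut out by [D], [f] strictly increases, hence takes distinct
    values, all among the [k] numbers below [k]. *)
Lemma max_part_set_comp_le (n k : nat) (D : seq nat) (f : nat -> nat) :
    0 < n ->
    (forall i, 0 < i <= n -> f i < k) ->
    (forall i, 0 < i < n -> i \notin D -> f i < f i.+1) ->
  max_part (set_comp n D) <= k.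
Proof.
move=> n_gt0 f_ltk f_incr; apply/bigmax_leqP_seq => p p_part _.
have [u [v [-> _ v_s no_cut]]] :=
  pairmap_subn_gap _ _ _ (path_filter_interval D n_gt0) p_part.
have le_vn : v <= n.
  move: v_s; rewrite mem_rcons inE mem_filter mem_iota add1n prednK //.
  by case/orP=> [/eqP-> // | /andP[_ /andP[_ /ltnW]]].
(* The block is [u + 1 .. v]: [f] climbs from its first element onwards. *)
have f_ge j : u + j < v -> j <= f (u + j).+1.
  elim: j => // j IHj; rewrite addnS => lt_v.
  apply: leq_ltn_trans (IHj (ltnW lt_v)) _.
  have lt_n := leq_trans lt_v le_vn.
  apply: f_incr => //; have := no_cut (u + j).+1.
  rewrite ltnS leq_addr lt_v => /(_ isT).
  rewrite mem_rcons inE mem_filter mem_iota add1n prednK // lt_n !andbT.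
  by rewrite negb_or => /andP[].
have [le_vu | lt_uv] := leqP v u; first by move/eqP: le_vu => ->.
have e : (u + (v - u).-1).+1 = v.
  by rewrite -addnS prednK ?subn_gt0 // subnKC // ltnW.
rewrite -(prednK (n := v - u)) ?subn_gt0 //.
apply: leq_ltn_trans (f_ltk v _); last by rewrite le_vn (leq_ltn_trans _ lt_uv).
by rewrite -[in f v]e f_ge // e.
Qed.

Lemma row_of_lt (n : nat) (alpha : seq nat) (T : filling) (i : nat) :
    is_comp n alpha -> std_filling alpha T -> 0 < i <= n ->
  row_of T i < size alpha.
Proof.
case/andP=> _ /eqP sum_alpha /andP[/eqP shapeT /perm_mem flatT] i_n.
rewrite -shapeT size_map -has_find; apply/hasP.
have /flattenP[r rT ir] : i \in flatten T.
  by rewrite flatT mem_iota sum_alpha add1n ltnS.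
by exists r.
Qed.

Lemma max_part_Des_RS (n : nat) (alpha : seq nat) (T : filling) :
    0 < n -> is_comp n alpha -> std_filling alpha T ->
  max_part (set_comp n (Des_RS n T)) <= size alpha.
Proof.
move=> n_gt0 comp_alpha stdT.
apply: (max_part_set_comp_le _ _ _ (row_of T)) => // i i_n.
  exact: row_of_lt comp_alpha stdT i_n.
by rewrite mem_filter mem_iota add1n prednK // i_n andbT -ltnNge.
Qed.

Lemma compl_comp_Des_S (n : nat) (T : filling) : 0 < n ->
  compl_comp n (set_comp n (Des_S n T)) = set_comp n (Des_RS n T).
Proof.
move=> n_gt0; rewrite /compl_comp set_compE //; congr set_comp.
apply: eq_in_filter => i i_n.
by rewrite !mem_filter i_n !andbT -leqNgt.
Qed.

Theorem corollary6p8 (n : nat) (alpha beta : seq nat)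
    (hn : 1 <= n) (halpha : is_comp n alpha) (hbeta : is_comp n beta) :
  [/\ (exists T, T \in SIT_S n alpha beta) ->
        max_part (compl_comp n beta) <= size alpha,
      (exists T, T \in SRIT_S n alpha beta) ->
        max_part (compl_comp n beta) <= size alpha,
      (exists T, T \in SIT_RS n alpha beta) ->
        max_part beta <= size alpha
    & (exists T, T \in SRIT_RS n alpha beta) ->
        max_part beta <= size alpha].
Proof.
split=> -[T /andP[/andP[stdT _] /eqP <-]]; rewrite ?compl_comp_Des_S //;
  exact: max_part_Des_RS.
Qed.
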